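(* Let $n,k,m$ be integers with $2\le k\le n-1$ and $2\le m\le k$. Let $\mathbf a=a_1\cdots a_n$ be a vertex of $G(n)$ such that there exist $m$ closed $k$-walks starting at $\mathbf a$ whose second vertices are pairwise distinct. Let $y_{\mathbf a}=y_1\cdots y_{n-1}=\mathrm{st}(a_2\cdots a_n)$ and $z_{\mathbf a}=z_1\cdots z_{n-k+1}=\mathrm{st}(a_1\cdots a_{n-k+1})$. Then one of the following holds: (a) $z_{n-k+1}=1$ and each of $1,\dots,m-1$ occurs among $y_1,\dots,y_{k-1}$; or $z_{n-k+1}=n-k+1$ and each of $n-m+1,\dots,n-1$ occurs among $y_1,\dots,y_{k-1}$; (b) there exist indices $i,j,\ell_1,\dots,\ell_{m-1}$ with $k-1<i,j\le n-1$ and $1\le\ell_1,\dots,\ell_{m-1}\le k-1$ such that $y_i=y_{\ell_1}-1=y_{\ell_2}-2=\cdots=y_{\ell_{m-1}}-(m-1)=y_j-m$ and $z_{i-k+1}+1=z_{n-k+1}=z_{j-k+1}-1$.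
   Context: For a sequence of distinct integers $c_1\cdots c_t$, $\mathrm{st}(c_1\cdots c_t)$ is the unique permutation $d_1\cdots d_t$ of $\{1,\dots,t\}$ with $d_i<d_j$ iff $c_i<c_j$. $G(n)$ is the directed multigraph whose vertices are the permutations of $\{1,\dots,n\}$ (one-line notation) and whose edges are the permutations $c_1\cdots c_{n+1}$ of $\{1,\dots,n+1\}$, the edge $c_1\cdots c_{n+1}$ going from $\mathrm{st}(c_1\cdots c_n)$ to $\mathrm{st}(c_2\cdots c_{n+1})$; so there is an edge from $x_1\cdots x_n$ to $w_1\cdots w_n$ iff $\mathrm{st}(x_2\cdots x_n)=\mathrm{st}(w_1\cdots w_{n-1})$. A closed $k$-walk $(v_1,\dots,v_k)$ is a sequence of vertices with an edge from $v_i$ to $v_{i+1}$ for $i<k$ and from $v_k$ to $v_1$.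
   Formalization: Here m is assumed to be the largest number of closed k-walks starting at a with pairwise distinct second vertices; with merely ''there exist m'' the claim fails, e.g. n=5, k=3, m=2, a=14325, where three such walks exist. *)

(* Defs.v *)
From mathcomp Require Import all_boot.

Set Implicit Arguments.
Unset Strict Implicit.
Unset Printing Implicit Defensive.

(* Words are sequences of naturals, with letters numbered from 1 as on paper;
   [entry c 0] is a junk value and is never meant to be used. *)
Definition entry (c : seq nat) (i : nat) : nat := nth 0 c i.-1.

(* All permutations of {1, ..., n} in one-line notation. *)
Definition perms (n : nat) : seq (seq nat) := permutations (iota 1 n).

(* The i-th letter of st c is the rank of c_i among the letters of c.  The
   lemmas st_perms, st_order and st_unique give the defining property. *)
Definition st (c : seq nat) : seq nat :=
  [seq (count (fun y => y < x) c).+1 | x <- c].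

Definition edge_source (n : nat) (c : seq nat) : seq nat := st (take n c).
Definition edge_target (c : seq nat) : seq nat := st (behead c).

(* Adjacency in the multigraph G(n), whose vertices are perms n and whose edges
   are perms n.+1. *)
Definition G_adj (n : nat) : rel (seq nat) := fun x w =>
  has (fun c => (edge_source n c == x) && (edge_target c == w)) (perms n.+1).

(* [cycle] includes the closing edge from v_k to v_1. *)
Definition closed_walk (n k : nat) (v : seq (seq nat)) : bool :=
  [&& size v == k, all (mem (perms n)) v & cycle (G_adj n) v].

Definition closed_walk_from (n k : nat) (a : seq nat) (v : seq (seq nat)) :
    bool :=
  closed_walk n k v && (nth [::] v 0 == a).

Definition second_vertex (v : seq (seq nat)) : seq nat := nth [::] v 1.

Definition has_closed_walks (n k : nat) (a : seq nat) (m : nat) : Prop :=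
  exists W : seq (seq (seq nat)),
    [/\ size W = m, all (closed_walk_from n k a) W
      & uniq (map second_vertex W)].

Lemma size_st (c : seq nat) : size (st c) = size c.
Proof. exact: size_map. Qed.

Lemma rank_lt (c : seq nat) (x y : nat) : x \in c ->
  (count (fun z => z < x) c < count (fun z => z < y) c) = (x < y).
Proof.
move=> xc; case: (ltnP x y) => [lt_xy | le_yx]; last first.
  apply/negbTE; rewrite -leqNgt; apply: sub_count => z /= lt_zy.
  exact: leq_trans lt_zy le_yx.
have -> : count (fun z => z < y) c =
    count (fun z => z < x) c + count (fun z => x <= z < y) c.
  elim: c {xc} => //= z c ->; rewrite addnACA; congr (_ + _).
  by case: (ltnP z x) => [lt_zx | _] /=; rewrite ?(ltn_trans lt_zx lt_xy).
rewrite -[X in X < _]addn0 ltn_add2l -has_count.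
by apply/hasP; exists x => //=; rewrite leqnn.
Qed.

Lemma st_order (c : seq nat) (i j : nat) : i < size c -> j < size c ->
  (nth 0 (st c) i < nth 0 (st c) j) = (nth 0 c i < nth 0 c j).
Proof.
move=> lti ltj; rewrite /st !(nth_map 0) // ltnS.
exact: rank_lt (mem_nth 0 lti).
Qed.

Lemma st_perms (c : seq nat) : uniq c -> st c \in perms (size c).
Proof.
move=> Uc; rewrite mem_permutations.
have Ust : uniq (st c).
  rewrite map_inj_in_uniq // => x y xc yc [exy].
  have := rank_lt y xc; have := rank_lt x yc; rewrite exy ltnn.
  by case: ltngtP.
have sub : {subset st c <= iota 1 (size c)}.
  move=> _ /mapP[x xc ->]; rewrite mem_iota add1n ltnS /=.
  rewrite -(count_predC (fun y => y < x) c) -[X in X < _]addn0 ltn_add2l.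
  by rewrite -has_count; apply/hasP; exists x => //=; rewrite ltnn.
apply: uniq_perm (iota_uniq _ _) _ => //.
by case: (uniq_min_size Ust sub); rewrite ?size_iota ?size_st.
Qed.

Lemma st_id (t : nat) (d : seq nat) : d \in perms t -> st d = d.
Proof.
rewrite mem_permutations => pd; rewrite -[RHS]map_id.
apply/eq_in_map => x; rewrite (perm_mem pd) mem_iota => /andP[x_gt0 x_le].
rewrite (permP pd) -[t in iota 1 t](subnKC (_ : x.-1 <= t)); last first.
  by case: x x_gt0 x_le => // x _; rewrite add1n !ltnS => /ltnW.
rewrite iotaD count_cat add1n prednK //.
rewrite (_ : count _ (iota 1 _) = x.-1); last first.
  rewrite -[RHS](size_iota 1); apply/eqP; rewrite -all_count.
  by apply/allP => z; rewrite mem_iota add1n prednK // => /andP[].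
rewrite (_ : count _ (iota x _) = 0) ?addn0 ?prednK //.
apply/eqP; rewrite -leqn0 leqNgt -has_count; apply/hasPn => z.
by rewrite mem_iota -leqNgt => /andP[].
Qed.

Lemma st_unique (c d : seq nat) : d \in perms (size c) ->
  (forall i j, i < size c -> j < size c ->
     (nth 0 d i < nth 0 d j) = (nth 0 c i < nth 0 c j)) ->
  d = st c.
Proof.
move=> pd ord_dc; rewrite -(st_id pd).
have szd : size d = size c.
  by move: pd; rewrite mem_permutations => /perm_size; rewrite size_iota.
apply: (@eq_from_nth _ 0) => [|i]; rewrite !size_st // szd => lti.
rewrite /st !(nth_map 0) ?szd //; congr _.+1.
have count_nth (e : seq nat) x : count (fun y => y < x) e =
    count (fun j => nth 0 e j < x) (iota 0 (size e)).
  by rewrite -[in LHS](mkseq_nth 0 e) count_map.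
rewrite !count_nth szd; apply: eq_in_count => j.
by rewrite mem_iota add0n => ltj /=; rewrite ord_dc.
Qed.

(* Main.v *)
(** The vertex w can be reached from x by a walk of length l <= n iff the last
    n - l letters of x have the same pattern as the first n - l letters of w.
    Hence the second vertices of the closed k-walks from a are the words
    obtained from y by appending a last letter v (and raising the letters >= v)
    such that appending v to Y = y_k ... y_(n-1) gives the pattern z.  That is a
    condition on the rank of v among the letters of Y only, so the admissible v
    form an interval; its length is m by maximality of m.  The values strictly
    between its ends are missing from Y, hence occur among y_1, ..., y_(k-1);
    each end of the interval is either an extreme value, giving (a), or next to
    a letter of Y, and two letters of Y give (b). *)

Require Import Defs.
From mathcomp Require Import all_boot zify.

Set Implicit Arguments.
Unset Strict Implicit.
Unset Printing Implicit Defensive.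

(** * Permutations and patterns *)

Lemma mem_perms (n : nat) (c : seq nat) : (c \in perms n) =
  [&& uniq c, size c == n & all (fun x => 0 < x <= n) c].
Proof.
rewrite mem_permutations; apply/idP/and3P => [pc | [Uc /eqP szc /allP rng]].
  rewrite (perm_uniq pc) iota_uniq (perm_size pc) size_iota eqxx.
  split=> //; apply/allP => x; rewrite (perm_mem pc) mem_iota; lia.
have sub : {subset c <= iota 1 n}.
  by move=> x /rng; rewrite mem_iota; lia.
apply: uniq_perm (iota_uniq _ _) _ => //.
by case: (uniq_min_size Uc sub); rewrite ?size_iota ?szc.
Qed.

(** A rank only counts comparisons with the other positions, so words that compare alike at all
    positions have equal ranks. *)
Lemma eq_st (c d : seq nat) : size c = size d ->
  (forall i j, i < size c -> j < size c ->
     (nth 0 c i < nth 0 c j) = (nth 0 d i < nth 0 d j)) ->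
  st c = st d.
Proof.
move=> szcd ord_cd; apply: (@eq_from_nth _ 0) => [|i]; rewrite !size_st //.
move=> lti; rewrite /st !(nth_map 0) -?szcd //; congr _.+1.
have count_nth (e : seq nat) x : count (fun y => y < x) e =
    count (fun j => nth 0 e j < x) (iota 0 (size e)).
  by rewrite -[in LHS](mkseq_nth 0 e) count_map.
rewrite !count_nth -szcd; apply: eq_in_count => j.
by rewrite mem_iota add0n => ltj /=; rewrite ord_cd.
Qed.

Lemma st_size (c d : seq nat) : st c = st d -> size c = size d.
Proof. by move=> e; rewrite -size_st e size_st. Qed.

Lemma st_lt (c d : seq nat) (i j : nat) : st c = st d ->
  i < size c -> j < size c ->
  (nth 0 c i < nth 0 c j) = (nth 0 d i < nth 0 d j).
Proof.
by move=> e li lj; rewrite -st_order // e st_order // -(st_size e).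
Qed.

Lemma st_idem (c : seq nat) : st (st c) = st c.
Proof.
by apply: eq_st => [|i j]; rewrite size_st // => li lj; rewrite st_order.
Qed.

Lemma st_drop (l : nat) (c d : seq nat) : st c = st d ->
  st (drop l c) = st (drop l d).
Proof.
move=> e; have sz := st_size e.
apply: eq_st => [|i j]; rewrite !size_drop ?sz // => li lj.
by rewrite !nth_drop (st_lt e) // sz; lia.
Qed.

Lemma st_take (l : nat) (c d : seq nat) : st c = st d ->
  st (take l c) = st (take l d).
Proof.
move=> e; have sz := st_size e.
have [le_lc | lt_cl] := leqP l (size c); last by rewrite !take_oversize //; lia.
apply: eq_st => [|i j]; rewrite !size_takel -?sz // => li lj.
by rewrite !nth_take // (st_lt e); lia.
Qed.

(** * Appending a last letter *)

(** For [s] in [perms n] and [v] in 1, ..., n+1 this is an edge of G(n) leaving [s]: [bump v] raises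
    the letters >= [v], which frees the value [v] and keeps the pattern of [s]. *)
Definition append_letter (v : nat) (s : seq nat) : seq nat :=
  rcons (map (bump v) s) v.

Lemma size_append (v : nat) (s : seq nat) :
  size (append_letter v s) = (size s).+1.
Proof. by rewrite size_rcons size_map. Qed.

Lemma take_append (v : nat) (s : seq nat) :
  take (size s) (append_letter v s) = map (bump v) s.
Proof. by rewrite /append_letter -(size_map (bump v)) -cats1 take_size_cat. Qed.

Lemma drop_append (l v : nat) (s : seq nat) : l <= size s ->
  drop l (append_letter v s) = append_letter v (drop l s).
Proof. by move=> le_l; rewrite drop_rcons ?size_map // -map_drop. Qed.

Lemma last_append (x v : nat) (s : seq nat) : last x (append_letter v s) = v.
Proof. by rewrite last_rcons. Qed.

Lemma ltn_bump2 (v x y : nat) : (bump v x < bump v y) = (x < y).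
Proof. by rewrite ltnNge leq_bump2 -ltnNge. Qed.

Lemma st_map_bump (v : nat) (s : seq nat) : st (map (bump v) s) = st s.
Proof.
apply: eq_st => [|i j]; rewrite size_map // => li lj.
by rewrite !(nth_map 0) // ltn_bump2.
Qed.

Lemma uniq_append (v : nat) (s : seq nat) :
  uniq (append_letter v s) = uniq s.
Proof.
rewrite rcons_uniq map_inj_uniq; last exact: can_inj (bumpK v).
by case: mapP => // -[x _ /eqP]; rewrite (negPf (neq_bump v x)).
Qed.

Lemma append_perms (n v : nat) (s : seq nat) : s \in perms n ->
  0 < v <= n.+1 -> append_letter v s \in perms n.+1.
Proof.
rewrite !mem_perms uniq_append size_append => /and3P[-> /eqP-> /allP rng] rv.
rewrite eqxx all_rcons rv /= all_map; apply/allP => x /rng /=.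
by rewrite /bump; lia.
Qed.

(** As [p] is its own standardization, each letter x of its prefix equals its rank there, plus one
    if the last letter is below x; this is [bump] of the rank. *)
Lemma perms_append (n : nat) (p : seq nat) : p \in perms n.+1 ->
  p = append_letter (last 0 p) (st (take n p)).
Proof.
move=> pp; move: (pp) (st_id pp); rewrite mem_perms.
case/lastP: p {pp} => [|s b]; rewrite ?size_rcons ?rcons_uniq //.
case/and3P=> /andP[bs _] /eqP[<-] _; rewrite last_rcons -cats1 take_size_cat //.
rewrite /st map_cat !cats1 => /rcons_inj[es _].
rewrite /append_letter; congr rcons; rewrite -map_comp -[LHS]map_id.
have {}es x : x \in s -> (count (fun y => y < x) s + (b < x)).+1 = x.
  move=> xs; have := congr1 (nth 0 ^~ (index x s)) es.
  rewrite (nth_map 0) ?index_mem // nth_index // => ex.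
  by rewrite -[RHS]ex -cats1 count_cat /= addn0.
apply/eq_in_map => x xs /=; have := es x xs.
have: b != x by apply: contraNneq bs => ->.
by rewrite /bump; lia.
Qed.

Lemma st_append (v : nat) (s : seq nat) : uniq s ->
  st (append_letter v s) = append_letter (count (ltn^~ v) s).+1 (st s).
Proof.
move=> Us; have := @st_perms (append_letter v s).
rewrite uniq_append size_append => /(_ Us) /perms_append {1}->.
have -> : last 0 (st (append_letter v s)) = (count (ltn^~ v) s).+1.
  rewrite {1}/st {1}/append_letter map_rcons last_rcons -cats1 count_cat /= ltnn.
  rewrite !addn0 count_map; congr _.+1; apply: eq_count => x /=.
  by rewrite /bump; lia.
by rewrite (st_take _ (st_idem _)) take_append st_map_bump.
Qed.

(** The inductive step for building walks. The new letter goes just above every letter of [s] whose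
    counterpart in [t] is below [b]; letters with counterpart above [b] exceed all of those, hence
    get raised. *)
Lemma append_match (N b : nat) (s t : seq nat) : st s = st t -> b \notin t ->
  all (fun x => 0 < x <= N) s ->
  exists2 v, 0 < v <= N.+1 & st (append_letter v s) = st (rcons t b).
Proof.
move=> e bt /all_nthP rng; have sz := st_size e.
(* The maximum over no index is 0, so the new letter is 1 when nothing in [t] is below [b]. *)
pose M := \max_(i < size s | nth 0 t i < b) nth 0 s i.
exists M.+1.
  rewrite ltnS /=; apply/bigmax_leqP => i _.
  by have /andP[] := rng 0 i (ltn_ord i).
have below i : i < size s -> (nth 0 s i < M.+1) = (nth 0 t i < b).
  move=> li; have nb : nth 0 t i != b.
    by apply: contraNneq bt => <-; rewrite mem_nth // -sz.
  case: (ltnP (nth 0 t i) b) => [lb | gb]; rewrite ?ltnS.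
    exact: (leq_bigmax_cond (Ordinal li)).
  apply/negbTE; rewrite -ltnNge; have /andP[s_gt0 _] := rng 0 i li.
  rewrite -(prednK s_gt0) ltnS; apply/bigmax_leqP => j lj.
  rewrite -ltnS prednK // (st_lt e) //; lia.
have above i : i < size s -> (M < bump M.+1 (nth 0 s i)) = (b < nth 0 t i).
  move=> li; have nb : nth 0 t i != b.
    by apply: contraNneq bt => <-; rewrite mem_nth // -sz.
  by have := below i li; rewrite /bump; lia.
apply: eq_st => [|i j]; rewrite size_append ?size_rcons ?sz // => li lj.
rewrite !nth_rcons !size_map sz.
have [ltj | gej] := ltnP j (size t); have [lti | gei] := ltnP i (size t).
- by rewrite !(nth_map 0) ?sz // ltn_bump2 (st_lt e) ?sz.
- have -> : i == size t by lia.
  rewrite (nth_map 0) ?sz // -above ?sz // /bump; lia.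
- have -> : j == size t by lia.
  rewrite (nth_map 0) ?sz // -below ?sz // /bump; lia.
- have -> : j == size t by lia.
  have -> : i == size t by lia.
  by rewrite !ltnn.
Qed.

(** * Walks in G(n) and overlapping patterns *)

Lemma perms_size (n : nat) (c : seq nat) : c \in perms n -> size c = n.
Proof. by rewrite mem_perms => /and3P[_ /eqP]. Qed.

Lemma perms_uniq (n : nat) (c : seq nat) : c \in perms n -> uniq c.
Proof. by rewrite mem_perms => /andP[]. Qed.

(** Both sides are the pattern of the edge without its first and last letters. *)
Lemma G_adj_overlap (n : nat) (x w : seq nat) : G_adj n x w ->
  st (behead x) = st (take n.-1 w).
Proof.
case/hasP=> c /perms_size szc /andP[/eqP<- /eqP<-].
rewrite (st_take _ (st_idem _)) -[behead (edge_source _ _)]drop1.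
rewrite (st_drop _ (st_idem _)); congr st.
by rewrite drop1; case: c n szc => // b c [|n] //= _; rewrite ?take0.
Qed.

(** Each edge forgets one more initial letter and keeps the pattern of the rest; induction on the
    walk. *)
Lemma walk_overlap (n : nat) (x : seq nat) (p : seq (seq nat)) :
  x \in perms n -> all (mem (perms n)) p -> path (G_adj n) x p ->
  size p <= n ->
  st (drop (size p) x) = st (take (n - size p) (last x p)).
Proof.
elim: p x => [|w p IHp] x px /=.
  by move=> _ _ _; rewrite drop0 subn0 -(perms_size px) take_size.
case/andP=> pw pp /andP[/G_adj_overlap adj walk] lt_pn.
rewrite -[X in drop X]addn1 -drop_drop drop1 (st_drop _ adj).
have := IHp w pw pp walk (ltnW lt_pn).
move/(st_take (n - (size p).+1)); rewrite take_drop.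
rewrite take_takel; last by lia.
by move=> <-; congr (st (drop _ (take _ _))); lia.
Qed.

(** Converse of [walk_overlap]: each step appends a letter that extends the match with [w] by one
    position. *)
Lemma overlap_walk (n l : nat) (x w : seq nat) :
  x \in perms n -> w \in perms n -> l <= n ->
  st (drop l x) = st (take (n - l) w) ->
  exists p, [/\ size p = l, all (mem (perms n)) p, path (G_adj n) x p
    & last x p = w].
Proof.
move=> + pw; have szw := perms_size pw.
elim: l x => [|l IHl] x px le_ln.
  rewrite drop0 subn0 -{1}szw take_size !(st_id px, st_id pw) => ->.
  by exists [::].
move=> e; have szx := perms_size px.
(* The first letter of [w] not yet matched by the end of [x]. *)
pose b := nth 0 w (n - l.+1).
have lt_w : n - l.+1 < size w by lia.
have eb : take (n - l) w = rcons (take (n - l.+1) w) b.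
  by rewrite -(take_nth 0) //; congr take; lia.
have nb : b \notin take (n - l.+1) w.
  by have := take_uniq (n - l) (perms_uniq pw); rewrite eb rcons_uniq => /andP[].
have rng : all (fun x => 0 < x <= n) (drop l.+1 x).
  move: px; rewrite mem_perms => /and3P[_ _ /allP rng].
  by apply/allP => u /mem_drop /rng.
have [v rv ev] := append_match e nb rng.
have pc := append_perms px rv; have szc := perms_size pc.
pose u := st (behead (append_letter v x)).
have pu : u \in perms n.
  have -> : n = size (behead (append_letter v x)) by rewrite size_behead szc.
  by apply: st_perms; rewrite -drop1 drop_uniq ?(perms_uniq pc).
have adj : G_adj n x u.
  apply/hasP; exists (append_letter v x) => //; rewrite eqxx andbT.
  by rewrite /edge_source -{1}szx take_append st_map_bump (st_id px).
have [|p [szp pp walk lastp]] := IHl u pu (ltnW le_ln).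
  rewrite (st_drop _ (st_idem _)) -drop1 drop_drop addn1.
  by rewrite drop_append ?szx // ev -eb.
by exists (u :: p); rewrite /= szp pu adj.
Qed.

(** A closed k-walk is an edge from [a] to [w] followed by a walk of length k-1 back to [a]; both
    lengths are at most n, so each part amounts to an overlap condition. *)
Lemma second_vertexP (n k : nat) (a w : seq nat) : 2 <= k <= n - 1 ->
  a \in perms n ->
  (exists2 v, closed_walk_from n k a v & second_vertex v = w) <->
  [/\ w \in perms n, st (take n.-1 w) = st (behead a)
    & st (drop k.-1 w) = st (take (n - k + 1) a)].
Proof.
move=> hk pa; split=> [[v /andP[/and3P[/eqP szv pv cyc] /eqP v0]] | [pw ea ez]].
  case: v szv pv cyc v0 => [|a' [|w' s]] /=; try lia.
  move=> szv /and3P[_ pw ps] /andP[adj walk] ea <-; subst a'.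
  rewrite /second_vertex /=; split=> //; first by rewrite (G_adj_overlap adj).
  have := walk_overlap pw _ walk; rewrite all_rcons /= pa ps size_rcons last_rcons.
  have -> : k.-1 = (size s).+1 by lia.
  move=> /(_ isT) ->; last by lia.
  by congr (st (take _ _)); lia.
have [||p1 [sz1 _ walk1 last1]] := @overlap_walk n 1 a w pa pw.
- by lia.
- by rewrite drop1 subn1.
have adj : G_adj n a w.
  by case: p1 sz1 walk1 last1 => [|u []] //= _ /andP[adj _] <-.
have [||p [szp pp walk lastp]] := @overlap_walk n k.-1 w a pw pa.
- by lia.
- by rewrite ez; congr (st (take _ _)); lia.
(* The path [p] ends at [a]; [belast] removes this repetition, since [cycle] supplies the closing
   edge. *)
exists (a :: belast w p); last by case: p szp {pp walk lastp} => //=; lia.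
rewrite /closed_walk_from eqxx andbT; apply/and3P; split.
- by rewrite /= size_belast szp; apply/eqP; lia.
- rewrite /= pa; apply/allP => u /mem_belast; rewrite inE.
  by case/predU1P=> [-> // | /(allP pp)].
- by rewrite /= -{2}lastp -lastI /= adj.
Qed.

(** * Counting on initial segments *)

(** The solutions in 1, ..., n form an initial segment, so their number is also the largest of
    them. *)
Lemma count_downset (P : pred nat) (n v : nat) :
  (forall u w, u <= w -> P w -> P u) -> 0 < v <= n ->
  P v = (v <= count P (iota 1 n)).
Proof.
move=> down rv; apply/idP/idP => [Pv | ].
  have -> : n = v + (n - v) by lia.
  rewrite iotaD count_cat; suff: all P (iota 1 v).
    by rewrite all_count size_iota => /eqP->; rewrite leq_addr.
  by apply/allP => u; rewrite mem_iota => ru; apply: down Pv; lia.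
apply: contraTT => nPv.
have -> : n = v.-1 + (n - v.-1) by lia.
rewrite iotaD count_cat -ltnNge.
have -> : count P (iota (1 + v.-1) (n - v.-1)) = 0.
  apply/eqP; rewrite -leqn0 leqNgt -has_count; apply/hasPn => u.
  by rewrite mem_iota => ru; apply: contra nPv; apply: down; lia.
by have := count_size P (iota 1 v.-1); rewrite size_iota; lia.
Qed.

Lemma count_ltS (v : nat) (s : seq nat) : uniq s ->
  count (ltn^~ v.+1) s = count (ltn^~ v) s + (v \in s).
Proof.
move=> Us; rewrite -count_uniq_mem //.
elim: s {Us} => //= x s ->; rewrite addnACA; congr (_ + _).
by rewrite ltnS; case: ltngtP.
Qed.

(** * The interval of admissible last letters *)

Theorem theorem3p11 (n k m : nat) (hk : 2 <= k <= n - 1) (hm : 2 <= m <= k)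
  (a : seq nat) (ha : a \in perms n)
  (hwalks : has_closed_walks n k a m)
  (hmax : forall m' : nat, has_closed_walks n k a m' -> m' <= m)
  (y z : seq nat)
  (hy : y = st (behead a))
  (hz : z = st (take (n - k + 1) a)) :
  ((entry z (n - k + 1) = 1 /\
      (forall v, 1 <= v <= m - 1 ->
         exists2 p, 1 <= p <= k - 1 & entry y p = v))
   \/
   (entry z (n - k + 1) = n - k + 1 /\
      (forall v, n - m + 1 <= v <= n - 1 ->
         exists2 p, 1 <= p <= k - 1 & entry y p = v)))
  \/
  (exists (i j : nat) (l : nat -> nat),
     [/\ k - 1 < i <= n - 1,
         k - 1 < j <= n - 1,
         (forall t, 1 <= t <= m - 1 ->
            1 <= l t <= k - 1 /\ entry y (l t) = entry y i + t),
         entry y j = entry y i + m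
       & entry z (i - k + 1) + 1 = entry z (n - k + 1) /\
         entry z (j - k + 1) = entry z (n - k + 1) + 1]).
Proof.
(* From here on the vertices have n+1 letters and [y] has n. *)
case: n => [|n] in hk ha hwalks hmax hz *; first by lia.
have py : y \in perms n.
  have -> : n = size (behead a) by rewrite size_behead (perms_size ha).
  by rewrite hy; apply: st_perms; rewrite -drop1 drop_uniq ?(perms_uniq ha).
have szy := perms_size py; have Uy := perms_uniq py.
have szz : size z = n.+1 - k + 1.
  by rewrite hz size_st size_takel ?(perms_size ha); lia.
pose Y := drop k.-1 y; pose c v := count (ltn^~ v) Y; pose r := last 0 z.
have UY : uniq Y by exact: drop_uniq.
have szY : size Y = n.+1 - k by rewrite size_drop szy; lia.
have pz : z \in perms (n.+1 - k).+1.
  have -> : (n.+1 - k).+1 = size (take (n.+1 - k + 1) a).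
    by rewrite size_takel ?(perms_size ha); lia.
  by rewrite hz; apply: st_perms; rewrite take_uniq ?(perms_uniq ha).
(* Appended to [Y], the letter [v] gets rank [(c v).+1], which must be the last letter [r] of
   [z]. *)
pose L := [seq v <- iota 1 n.+1 | (c v).+1 == r].
have stY v : st (drop k.-1 (append_letter v y)) =
    append_letter (c v).+1 (st Y).
  by rewrite drop_append ?st_append //; lia.
have appL w : w \in perms n.+1 -> st (take n w) = st (behead a) ->
    st (drop k.-1 w) = z ->
    [/\ last 0 w \in L, w = append_letter (last 0 w) y
      & z = append_letter r (st Y)].
  move=> pw; have ew := perms_append pw; move: ew.
  set v := last 0 w => ew ey ez; rewrite ey -hy in ew.
  have rv : 0 < v <= n.+1.
    move: pw; rewrite mem_perms => /and3P[_ _ /allP]; apply.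
    by rewrite ew /append_letter mem_rcons mem_head.
  move: ez; rewrite ew stY => ez.
  have er : r = (c v).+1 by rewrite /r -ez last_append.
  split; rewrite ?er ?last_append // mem_filter er eqxx mem_iota; lia.
have [W [szW /allP walksW UW]] := hwalks.
have validW v : v \in W -> [/\ last 0 (second_vertex v) \in L,
    second_vertex v = append_letter (last 0 (second_vertex v)) y
      & z = append_letter r (st Y)].
  move=> vW; have [|pw ey ez] := (second_vertexP (second_vertex v) hk ha).1.
    by exists v => //; exact: walksW.
  by apply: appL; rewrite // ez.
have ez : z = append_letter r (st Y).
  case: W szW validW {walksW UW} => [|v W] /=; first by lia.
  by move=> _ /(_ v (mem_head _ _))[].
have UL : uniq L by rewrite filter_uniq ?iota_uniq.
have le_mL : m <= size L.
  rewrite -szW -(size_map second_vertex) -(size_map (append_letter^~ y) L).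
  apply: uniq_leq_size UW _ => _ /mapP[v vW ->].
  by have [vL -> _] := validW v vW; apply: map_f.
have le_Lm : size L <= m.
  apply: hmax.
  have walkL v : v \in L -> exists2 s, closed_walk_from n.+1 k a s
      & second_vertex s = append_letter v y.
    rewrite mem_filter mem_iota => /andP[/eqP er rv].
    apply/(second_vertexP _ hk ha); split; first by apply: append_perms; lia.
      by rewrite -pred_Sn -{1}szy take_append st_map_bump -hy (st_id py).
    by rewrite stY er -ez -hz.
  (* One walk is picked for each letter of [L], by induction on the list. *)
  have [W' eW' wW'] : exists2 W',
      map second_vertex W' = map (append_letter^~ y) L
      & all (closed_walk_from n.+1 k a) W'.
    elim: (L) walkL => [|v L' IHL] walkL; first by exists [::].
    have [u uL | W' eW' wW'] := IHL; first by apply: walkL; rewrite inE uL orbT.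
    have [s ws es] := walkL v (mem_head _ _).
    by exists (s :: W'); rewrite /= ?es ?eW' // ws.
  exists W'; split=> //; first by rewrite -(size_map second_vertex) eW' size_map.
  rewrite eW' map_inj_uniq // => u v euv.
  by rewrite -(last_append 0 u y) euv last_append.
have {le_mL le_Lm} szL : size L = m by lia.
(* Since [c] is monotone, [L] consists of A+1, ..., A+m. *)
pose A := count (fun v => (c v).+1 < r) (iota 1 n.+1).
have monoc u v : u <= v -> c u <= c v.
  by move=> le_uv; apply: sub_count => x /= /leq_trans; apply.
have cltP v : 0 < v <= n.+1 -> ((c v).+1 < r) = (v <= A).
  by move/count_downset; apply=> u w /monoc; lia.
have eAm : A + m = count (fun v => (c v).+1 <= r) (iota 1 n.+1).
  rewrite -szL size_filter /A; elim: (iota _ _) => //= u s <-.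
  by rewrite addnACA; congr (_ + _); case: ltngtP.
have cleP v : 0 < v <= n.+1 -> ((c v).+1 <= r) = (v <= A + m).
  by rewrite eAm; move/count_downset; apply=> u w /monoc; lia.
have le_Am : A + m <= n.+1.
  by rewrite eAm -[leqRHS](size_iota 1); apply: count_size.
have cS v : c v.+1 = c v + (v \in Y) by apply: count_ltS.
have yP v : 0 < v <= n -> v \in y.
  move=> rv; move: py; rewrite mem_permutations => /perm_mem->.
  by rewrite mem_iota; lia.
(* Here v and v+1 both lie in [L], so [c] does not jump at v and v is not in [Y]. *)
have early v : A < v < A + m -> exists2 p, 1 <= p <= k - 1 & entry y p = v.
  move=> rv; have vY : v \notin Y.
    have := cS v; case: (v \in Y) => //.
    by have := cltP v; have := cleP v.+1; lia.
  have vt : v \in take k.-1 y.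
    have: v \in take k.-1 y ++ Y by rewrite cat_take_drop; apply: yP; lia.
    by rewrite mem_cat (negPf vY) orbF.
  have: index v (take k.-1 y) < k.-1.
    by rewrite -index_mem size_takel in vt; rewrite ?szy; lia.
  set q := index v _ => ltq; exists q.+1; first by lia.
  by rewrite /entry /= -(nth_take 0 ltq) nth_index.
(* Position i of [y] is position i-k+1 of [Y], hence of [z], where the rank of v in [Y] is raised by
   [bump r]. *)
have late v : v \in Y -> exists2 i, k - 1 < i <= n
    & entry y i = v /\ entry z (i - k + 1) = bump r (c v).+1.
  move=> vY; have lti : index v Y < size Y by rewrite index_mem.
  exists (k + index v Y); first by lia.
  split; rewrite /entry.
    have -> : (k + index v Y).-1 = k.-1 + index v Y by lia.
    by rewrite -nth_drop nth_index.
  have -> : (k + index v Y - k + 1).-1 = index v Y by lia.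
  rewrite ez nth_rcons size_map size_st lti (nth_map 0) ?size_st //.
  by rewrite (nth_map 0) // nth_index.
have er : entry z (n.+1 - k + 1) = r by rewrite /entry -szz nth_last.
have c1 : c 1 = 0.
  have c0 : c 0 = 0 by rewrite /c (eq_count (a2 := pred0)) ?count_pred0.
  apply/eqP; rewrite cS c0 add0n eqb0; apply/negP => /mem_drop.
  by move: py; rewrite mem_permutations => /perm_mem->; rewrite mem_iota.
have cn : c n.+1 = n.+1 - k.
  rewrite -szY; apply/eqP; rewrite -all_count; apply/allP => u /mem_drop.
  move: py; rewrite mem_permutations => /perm_mem->; rewrite mem_iota /= add1n.
  by case/andP.
(* If A = 0, then 1 is in [L] and r = c(1)+1 = 1. *)
rewrite er; have [A0 | A_gt0] := posnP A.
  left; left; split; last by move=> v rv; apply: early; lia.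
  by have := cltP 1; have := cleP 1; lia.
(* If A+m = n+1, then n+1 is in [L] and r = c(n+1)+1, the length of [z]. *)
have [An | ltA] := eqVneq (A + m) n.+1.
  left; right; split; last by move=> v rv; apply: early; lia.
  by have := cltP n.+1; have := cleP n.+1; lia.
(* Otherwise [c] jumps at A and at A+m, just before and at the end of [L], so both are letters of
   [Y], of ranks r-1 and r; [bump r] turns these into r-1 and r+1. *)
right; have cA1 := cleP A.+1; have cA1' := cltP A.+1; have cA := cltP A.
have cB := cleP (A + m); have cB' := cltP (A + m); have cB1 := cleP (A + m).+1.
have sA := cS A; have sB := cS (A + m).
have AY : A \in Y by move: sA; case: (A \in Y) => //; lia.
have BY : A + m \in Y by move: sB; case: (A + m \in Y) => //; lia.
rewrite AY in sA; rewrite BY in sB.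
have [i ri [yi zi]] := late A AY; have [j rj [yj zj]] := late (A + m) BY.
pose l t := (index (A + t) y).+1.
exists i, j, l; split; [lia | lia | | by rewrite yi yj |].
  move=> t rt; have [|p rp] := early (A + t); first by lia.
  rewrite yi /entry => ep; have -> : l t = p.
    by rewrite /l -ep index_uniq ?szy ?prednK; lia.
  by rewrite ep.
by rewrite zi zj /bump; lia.
Qed.
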